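(* Let $\Bbbk$ be a field and let $(V,\Delta,\epsilon,\zeta)$ be a linearly compact combinatorial coalgebra over $\Bbbk$. Then the map $\psi:V\to\widehat{\mathsf{QSym}}$, $\psi(v)=\sum_\alpha\zeta_\alpha(v)M_\alpha$ (sum over all compositions $\alpha$), is the unique morphism of linearly compact combinatorial coalgebras $(V,\zeta)\to(\widehat{\mathsf{QSym}},\zeta_{\mathsf{QSym}})$. If $(V,\zeta)$ is a linearly compact combinatorial bialgebra, then $\psi$ is a morphism of linearly compact bialgebras.
   Context: Linearly compact spaces. A linearly compact $\Bbbk$-vector space is a topological vector space of the form $V=\prod_{i\in I}\Bbbk v_i$ with the product topology, each line $\Bbbk v_i$ being discrete; $\{v_i\}$ is a pseudobasis (each $v\in V$ is uniquely a possibly infinite sum $\sum_ic_iv_i$). Morphisms are continuous linear maps. If $V,W$ have pseudobases $\{v_i\},\{w_j\}$, the completed tensor product $V\hat\otimes W$ is the linearly compact space with pseudobasis $\{v_i\otimes w_j\}$ (intrinsically $(V^\vee\otimes W^\vee)^*$ with $\vee$ the continuous dual). With unit object $\Bbbk$ and braiding $x\otimes y\mapsto y\otimes x$ this is a symmetric monoidal category; linearly compact algebras, coalgebras, bialgebras are the monoids, comonoids, bimonoids in it. $\Bbbk[[t]]$ is the linearly compact algebra with pseudobasis $\{t^n\}_{n\ge0}$. For a map $\zeta:V\to\Bbbk[[t]]$, $\zeta|_{t=0}:V\to\Bbbk$ takes the constant term. A linearly compact combinatorial coalgebra is $(V,\Delta,\epsilon,\zeta)$ with $(V,\Delta,\epsilon)$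 a linearly compact coalgebra and $\zeta:V\to\Bbbk[[t]]$ a continuous linear map with $\zeta|_{t=0}=\epsilon$. A linearly compact combinatorial bialgebra is a linearly compact bialgebra with a morphism of linearly compact algebras $\zeta:V\to\Bbbk[[t]]$ with $\zeta|_{t=0}=\epsilon$. A morphism $\phi:(V,\zeta)\to(V',\zeta')$ of these objects is a continuous coalgebra (respectively bialgebra) morphism with $\zeta=\zeta'\circ\phi$. A composition $\alpha\vDash n$ is a sequence $\alpha=(\alpha_1,\dots,\alpha_l)$ of positive integers with sum $n$; $\emptyset$ is the composition of $0$. $M_\alpha=\sum_{i_1<\cdots<i_l}x_{i_1}^{\alpha_1}\cdots x_{i_l}^{\alpha_l}\in\Bbbk[[x_1,x_2,\dots]]$, $M_\emptyset=1$. $\widehat{\mathsf{QSym}}$ is the linearly compact space with pseudobasis $\{M_\alpha\}$ over all compositions $\alpha$; it is a linearly compact bialgebra with the product of power series, coproduct the continuous linear map with $\Delta(M_\alpha)=\sum_{\alpha=\beta\gamma}M_\beta\otimes M_\gamma$ (over concatenations), and counit $\epsilon(M_\emptyset)=1$, $\epsilon(M_\alpha)=0$ for $\alpha\neq\emptyset$. $\zeta_{\mathsf{QSym}}:\widehat{\mathsf{QSym}}\to\Bbbk[[t]]$ is the continuous linear (and algebra) map with $M_\emptyset\mapsto1$, $M_{(n)}\mapsto t^n$ for $n\ge1$, $M_\alpha\mapsto0$ for all other $\alpha$. For a linearly compact combinatorial coalgebra $(V,\Delta,\epsilon,\zeta)$ let $\Delta^{(0)}=\mathrm{id}$, $\Delta^{(1)}=\Delta$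 and $\Delta^{(m-1)}=(\Delta^{(m-2)}\hat\otimes\mathrm{id})\circ\Delta:V\to V^{\hat\otimes m}$ for $m>2$. Let $\zeta_\emptyset=\zeta|_{t=0}=\epsilon$, and for $\alpha=(\alpha_1,\dots,\alpha_m)\vDash n>0$ let $\zeta_\alpha(v)$ be the coefficient of $t^{\alpha_1}\otimes\cdots\otimes t^{\alpha_m}$ in $\zeta^{\hat\otimes m}(\Delta^{(m-1)}(v))\in\Bbbk[[t]]^{\hat\otimes m}$. *)

(* Defs.v *)
From HB Require Import structures.
From mathcomp Require Import all_boot all_order all_algebra finmap.
From mathcomp Require Import all_classical topology.

Set Implicit Arguments.
Unset Strict Implicit.
Unset Printing Implicit Defensive.

Import GRing.Theory.

Local Open Scope classical_set_scope.
Local Open Scope ring_scope.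

(* mathcomp-analysis only has topological modules over a numDomainType; here
   the (discrete) field of scalars is arbitrary.  Continuity of + and *: is not
   required: it follows from lcSpace below. *)
#[short(type="topLmodType")]
HB.structure Definition TopLmod (K : nzRingType) :=
  {M of Topological M & GRing.Lmodule K M}.

(* The field K as a discrete line. *)
Definition kline (K : fieldType) : Type := discrete_topology K.

HB.instance Definition _ (K : fieldType) :=
  Topological.copy (kline K) (discrete_topology K).
HB.instance Definition _ (K : fieldType) := GRing.Lmodule.copy (kline K) K^o.

(* The product of I copies of the discrete line. *)
Definition kpow (K : fieldType) (I : Type) : Type := I -> K.

HB.instance Definition _ (K : fieldType) (I : Type) :=
  Topological.copy (kpow K I) (prod_topology (fun _ : I => kline K)).
HB.instance Definition _ (K : fieldType) (I : Type) :=
  GRing.Lmodule.copy (kpow K I) (I -> K^o).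

(* A topological vector space with a pseudobasis (v_i), given by its linear
   homeomorphism with the product of lines: lc_coord v i is the coefficient of
   v_i in v, and lc_sum c is the infinite sum of the c_i v_i. *)
Record lcSpace (K : fieldType) := LCSpace {
  lc_space :> topLmodType K;
  lc_idx : Type;
  lc_coord : lc_space -> kpow K lc_idx;
  lc_sum : kpow K lc_idx -> lc_space;
  lc_coord_linear : linear lc_coord;
  lc_coordK : cancel lc_coord lc_sum;
  lc_sumK : cancel lc_sum lc_coord;
  lc_coord_continuous : continuous lc_coord;
  lc_sum_continuous : continuous lc_sum
}.

(* Morphisms of linearly compact spaces. *)
Definition lc_map (K : fieldType) (V W : lcSpace K) (f : V -> W) : Prop :=
  linear f /\ continuous f.

Section Continuity.
Context {K : fieldType}.

Lemma id_continuous (T : topologicalType) : continuous (@id T).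
Proof. by move=> x; exact: cvg_id. Qed.

Lemma kpow_proj_continuous (I : Type) (i : I) :
  continuous (fun c : kpow K I => c i : kline K).
Proof.
move=> c; have cc : nbhs c --> c by exact: cvg_id.
have /cvg_sup/(_ i) ci := cc.
by move=> A /(@initial_continuous _ _ (fun f : I -> kline K => f i)) /ci.
Qed.

Lemma kpow_continuous (T : topologicalType) (I : Type) (f : T -> kpow K I) :
  (forall i, continuous (fun x => f x i : kline K)) -> continuous f.
Proof.
move=> cf x; apply/cvg_sup => i A [_ [[B Bop <-] Bfx] sBA].
apply: filterS sBA _; apply: (cf i x).
exact: open_nbhs_nbhs.
Qed.

Lemma kline_cst_continuous (T : topologicalType) (a : K) :
  continuous (fun _ : T => a : kline K).
Proof. by move=> x; exact: cvg_cst. Qed.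

Lemma kline_op2_continuous (T : topologicalType) (h : K -> K -> K)
    (f g : T -> kline K) :
  continuous f -> continuous g -> continuous (fun x => h (f x) (g x) : kline K).
Proof.
have set1 (a : kline K) : nbhs a [set a] by exact: (@discrete_set1 (discrete_topology K)).
move=> cf cg x A /nbhs_singleton /= Ax.
have fx : nbhs x (f @^-1` [set f x]) := cf x _ (set1 (f x)).
have gx : nbhs x (g @^-1` [set g x]) := cg x _ (set1 (g x)).
change (nbhs x (fun y => A (h (f y) (g y)))).
by apply: filterS (filterI fx gx) => y [/= -> ->].
Qed.

Lemma kline_sum_continuous (T : topologicalType) (J : Type) (r : seq J)
    (F : J -> T -> kline K) :
  (forall j, continuous (F j)) ->
  continuous (fun x => \sum_(j <- r) (F j x : K) : kline K).
Proof.
move=> cF; elim: r => [|j r IH].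
  rewrite (_ : (fun x => _) = (fun=> (0 : K) : kline K)); last first.
    by apply/funext => x; rewrite big_nil.
  exact: kline_cst_continuous.
rewrite (_ : (fun x => _) =
    (fun x => (F j x : K) + \sum_(j <- r) (F j x : K) : kline K)); last first.
  by apply/funext => x; rewrite big_cons.
exact: kline_op2_continuous.
Qed.

End Continuity.

Section Monoidal.
Context {K : fieldType}.

Definition lc_prod (I : Type) : lcSpace K :=
  @LCSpace K (kpow K I) I id id (fun _ _ _ => erefl) (fun _ => erefl)
    (fun _ => erefl) (@id_continuous _) (@id_continuous _).

Fact kpow_unitK :
  cancel (fun c : kpow K unit => c tt) (fun (a : K) (_ : unit) => a).
Proof. by move=> c; apply/funext => -[]. Qed.

(* The unit object: K with pseudobasis {1}. *)
Definition lc_unit : lcSpace K :=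
  @LCSpace K (kline K) unit (fun c _ => c) (fun c => c tt)
    (fun _ _ _ => erefl) (fun _ => erefl)
    kpow_unitK
    (kpow_continuous (fun _ => @id_continuous (kline K)))
    (@kpow_proj_continuous K unit tt).

Definition lc_tens (V W : lcSpace K) : lcSpace K :=
  lc_prod (lc_idx V * lc_idx W).

Definition lc_pure (V W : lcSpace K) (v : V) (w : W) : lc_tens V W :=
  fun p => lc_coord v p.1 * lc_coord w p.2.

(* For morphisms f and g, the completed tensor product of f and g, i.e. the
   continuous linear map sending lc_pure v w to lc_pure (f v) (g w): apply g to
   each slice z (i, -), then f to each slice of the result. *)
Definition lc_tmap (V W V' W' : lcSpace K) (f : V -> V') (g : W -> W')
    (z : lc_tens V W) : lc_tens V' W' :=
  fun p => lc_coord (f (lc_sum (fun i =>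
             lc_coord (g (lc_sum (fun j => z (i, j)))) p.2))) p.1.

(* Associator, unitors and middle-four interchange; on pure tensors,
   lc_mid4 ((a * b) * (c * d)) = (a * c) * (b * d). *)
Definition lc_assoc (U V W : lcSpace K) (z : lc_tens (lc_tens U V) W) :
  lc_tens U (lc_tens V W) := fun p => z ((p.1, p.2.1), p.2.2).

Definition lc_lunit (V : lcSpace K) (z : lc_tens lc_unit V) : V :=
  lc_sum (fun i => z (tt, i)).

Definition lc_runit (V : lcSpace K) (z : lc_tens V lc_unit) : V :=
  lc_sum (fun i => z (i, tt)).

Definition lc_mid4 (A B C D : lcSpace K)
    (z : lc_tens (lc_tens A B) (lc_tens C D)) :
  lc_tens (lc_tens A C) (lc_tens B D) :=
  fun p => z ((p.1.1, p.2.1), (p.1.2, p.2.2)).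

Lemma lc_sum_linear (V : lcSpace K) : linear (@lc_sum K V).
Proof.
move=> a x y; apply: (can_inj (@lc_coordK K V)).
by rewrite lc_coord_linear !lc_sumK.
Qed.

Lemma lc_sumZ (V : lcSpace K) (a : K) (c : lc_idx V -> K) :
  lc_sum (fun i => a * c i) = a *: (lc_sum c : V).
Proof.
have s0 : lc_sum (0 : kpow K (lc_idx V)) = 0 :> V.
  have := @lc_sum_linear V (- 1) 0 0.
  by rewrite addr0 scaler0 scaleN1r addrC subrr.
have := @lc_sum_linear V a c 0.
by rewrite addr0 s0 addr0.
Qed.

Lemma lc_coordZ (V : lcSpace K) (a : K) (v : V) i :
  lc_coord (a *: v) i = a * lc_coord v i.
Proof.
have c0 : lc_coord (0 : V) = 0.
  have := @lc_coord_linear K V (- 1) 0 0.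
  by rewrite addr0 scaler0 scaleN1r addrC subrr.
have := @lc_coord_linear K V a v 0.
by rewrite addr0 c0 addr0 => ->.
Qed.

Lemma lc_tmap_pure (V W V' W' : lcSpace K) (f : V -> V') (g : W -> W') v w :
  linear f -> linear g ->
  lc_tmap f g (lc_pure v w) = lc_pure (f v) (g w).
Proof.
have hom (X Y : lcSpace K) (h : X -> Y) : linear h ->
    forall a x, h (a *: x) = a *: h x.
  move=> lh a x; have h0 : h 0 = 0.
    by have := lh (- 1) 0 0; rewrite addr0 scaler0 scaleN1r addrC subrr.
  by have := lh a x 0; rewrite addr0 h0 addr0.
move=> /hom fZ /hom gZ; apply/funext => -[i' j'].
rewrite /lc_tmap /lc_pure /=.
under eq_fun do rewrite lc_sumZ gZ lc_coordZ lc_coordK mulrC.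
by rewrite lc_sumZ fZ lc_coordZ lc_coordK mulrC.
Qed.

Lemma lc_tmap_id (V W : lcSpace K) : lc_tmap (@id V) (@id W) = id.
Proof.
apply/funext => z; apply/funext => -[i j]; rewrite /lc_tmap /=.
by rewrite lc_sumK lc_sumK.
Qed.

End Monoidal.

Arguments lc_prod : clear implicits.
Arguments lc_unit : clear implicits.

Record lcAlgebra (K : fieldType) := LCAlgebra {
  alg_space :> lcSpace K;
  lc_mul : lc_tens alg_space alg_space -> alg_space;
  lc_one : lc_unit K -> alg_space;
  lc_mul_map : lc_map lc_mul;
  lc_one_map : lc_map lc_one;
  lc_mulA : forall z : lc_tens (lc_tens alg_space alg_space) alg_space,
    lc_mul (lc_tmap lc_mul id z) = lc_mul (lc_tmap id lc_mul (lc_assoc z));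
  lc_mul1l : forall z : lc_tens (lc_unit K) alg_space,
    lc_mul (lc_tmap lc_one id z) = lc_lunit z;
  lc_mul1r : forall z : lc_tens alg_space (lc_unit K),
    lc_mul (lc_tmap id lc_one z) = lc_runit z
}.

Record lcCoalgebra (K : fieldType) := LCCoalgebra {
  coalg_space :> lcSpace K;
  lc_comul : coalg_space -> lc_tens coalg_space coalg_space;
  lc_counit : coalg_space -> lc_unit K;
  lc_comul_map : lc_map lc_comul;
  lc_counit_map : lc_map lc_counit;
  lc_comulA : forall v,
    lc_assoc (lc_tmap lc_comul id (lc_comul v)) =
    lc_tmap id lc_comul (lc_comul v);
  lc_counitl : forall v, lc_lunit (lc_tmap lc_counit id (lc_comul v)) = v;
  lc_counitr : forall v, lc_runit (lc_tmap id lc_counit (lc_comul v)) = v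
}.

(* The last four axioms say that lc_comul and lc_counit are algebra morphisms
   (equivalently, that lc_mul and lc_one are coalgebra morphisms). *)
Record lcBialgebra (K : fieldType) := LCBialgebra {
  bialg_alg :> lcAlgebra K;
  bi_comul : bialg_alg -> lc_tens bialg_alg bialg_alg;
  bi_counit : bialg_alg -> lc_unit K;
  bi_comul_map : lc_map bi_comul;
  bi_counit_map : lc_map bi_counit;
  bi_comulA : forall v,
    lc_assoc (lc_tmap bi_comul id (bi_comul v)) =
    lc_tmap id bi_comul (bi_comul v);
  bi_counitl : forall v, lc_lunit (lc_tmap bi_counit id (bi_comul v)) = v;
  bi_counitr : forall v, lc_runit (lc_tmap id bi_counit (bi_comul v)) = v;
  bi_comulM : forall z : lc_tens bialg_alg bialg_alg,
    bi_comul (lc_mul z) =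
    lc_tmap (@lc_mul K bialg_alg) (@lc_mul K bialg_alg)
      (lc_mid4 (lc_tmap bi_comul bi_comul z));
  bi_comul1 : forall c : lc_unit K,
    bi_comul (lc_one bialg_alg c) =
    lc_tmap (@lc_one K bialg_alg) (@lc_one K bialg_alg)
      (lc_pure c ((1 : K) : lc_unit K));
  bi_counitM : forall z : lc_tens bialg_alg bialg_alg,
    bi_counit (lc_mul z) = lc_lunit (lc_tmap bi_counit bi_counit z);
  bi_counit1 : forall c : lc_unit K, bi_counit (lc_one bialg_alg c) = c
}.

Definition bialg_coalg (K : fieldType) (V : lcBialgebra K) : lcCoalgebra K :=
  @LCCoalgebra K V _ _ (@bi_comul_map K V) (@bi_counit_map K V)
    (@bi_comulA K V) (@bi_counitl K V) (@bi_counitr K V).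

Record lc_alg_mor (K : fieldType) (A B : lcAlgebra K) (f : A -> B) : Prop := {
  alg_mor_map : lc_map f;
  alg_morM : forall z : lc_tens A A, f (lc_mul z) = lc_mul (lc_tmap f f z);
  alg_mor1 : forall c : lc_unit K, f (lc_one A c) = lc_one B c
}.

Record lc_coalg_mor (K : fieldType) (A B : lcCoalgebra K) (f : A -> B) : Prop
    := {
  coalg_mor_map : lc_map f;
  coalg_mor_comul : forall v, lc_comul (f v) = lc_tmap f f (lc_comul v);
  coalg_mor_counit : forall v, lc_counit (f v) = lc_counit v
}.

Definition lc_bialg_mor (K : fieldType) (A B : lcBialgebra K) (f : A -> B) :
    Prop :=
  lc_alg_mor f /\ @lc_coalg_mor K (bialg_coalg A) (bialg_coalg B) f.

Record composition := Comp { parts : seq nat; _ : all (leq 1) parts }.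
HB.instance Definition _ := [isSub for parts].
HB.instance Definition _ := [Choice of composition by <:].

Definition comp_nil : composition := @Comp [::] isT.

Fact comp_cat_subproof (a b : composition) : all (leq 1) (val a ++ val b).
Proof. by rewrite all_cat (valP a) (valP b). Qed.

Definition comp_cat (a b : composition) : composition := Comp (comp_cat_subproof a b).

(* The composition obtained from s by erasing zeros. *)
Definition strip (s : seq nat) : composition :=
  @Comp (seq.filter (leq 1) s) (filter_all _ s).

Section SumOverSplittings.
Context {K : fieldType}.
Implicit Types s : seq nat.

(* Sum of the G p q over pairs of sequences with pointwise sum s. *)
Fixpoint ssum s (G : seq nat -> seq nat -> K) : K :=
  if s is a :: s' then
    \sum_(0 <= i < a.+1) ssum s' (fun p q => G (i :: p) ((a - i)%N :: q))
  else G [::] [::].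

Fixpoint splits s : seq (seq nat * seq nat) :=
  if s is a :: s' then
    [seq (i :: p.1, (a - i)%N :: p.2) | i <- index_iota 0 a.+1, p <- splits s']
  else [:: ([::], [::])].

Lemma ssum_cons a s G :
  ssum (a :: s) G =
  \sum_(0 <= i < a.+1) ssum s (fun p q => G (i :: p) ((a - i)%N :: q)).
Proof. by []. Qed.

Lemma splits_cons a s :
  splits (a :: s) = [seq (i :: p.1, (a - i)%N :: p.2)
                    | i <- index_iota 0 a.+1, p <- splits s].
Proof. by []. Qed.

Lemma eq_ssum s G H : (forall p q, G p q = H p q) -> ssum s G = ssum s H.
Proof.
by move=> GH; congr ssum; apply/funext => p; apply/funext => q; exact: GH.
Qed.

Lemma ssumE s G : ssum s G = \sum_(p <- splits s) G p.1 p.2.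
Proof.
elim: s G => [|a s IH] G; first by rewrite /= big_seq1.
rewrite ssum_cons splits_cons.
by rewrite big_allpairs_dep; apply: eq_bigr => i _; rewrite IH.
Qed.

Lemma ssum_sum s (r : seq nat) (G : nat -> seq nat -> seq nat -> K) :
  ssum s (fun p q => \sum_(i <- r) G i p q) = \sum_(i <- r) ssum s (G i).
Proof.
rewrite ssumE exchange_big /=; apply: eq_bigr => i _; by rewrite ssumE.
Qed.

Lemma ssum_cat s t G :
  ssum (s ++ t) G =
  ssum s (fun p q => ssum t (fun p' q' => G (p ++ p') (q ++ q'))).
Proof.
by elim: s G => [|a s IH] G //=; apply: eq_bigr => i _; rewrite IH.
Qed.

Lemma ssum_filter s (H : seq nat -> seq nat -> K) :
  ssum s (fun p q => H (seq.filter (leq 1) p) (seq.filter (leq 1) q)) =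
  ssum (seq.filter (leq 1) s)
    (fun p q => H (seq.filter (leq 1) p) (seq.filter (leq 1) q)).
Proof.
elim: s H => [|[|a] s IH] H //.
  by rewrite [LHS]/= big_nat1 /= IH.
rewrite [seq.filter _ (a.+1 :: s)]/=.
rewrite [LHS]/= [RHS]/=; apply: eq_bigr => i _.
pose c (j : nat) (x : seq nat) := if (0 < j)%N then j :: x else x.
by rewrite (IH (fun x y => H (c i x) (c (a.+1 - i)%N y))).
Qed.

Lemma sum_triangle n (F : nat -> nat -> nat -> K) :
  \sum_(0 <= i < n.+1) \sum_(0 <= j < i.+1) F j (i - j)%N (n - i)%N =
  \sum_(0 <= j < n.+1) \sum_(0 <= k < (n - j).+1) F j k (n - j - k)%N.
Proof.
elim: n F => [|n IH] F; first by rewrite !big_nat1.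
rewrite [RHS]big_nat_recl // subn0.
under [LHS]eq_bigr => i _ do rewrite big_nat_recl //.
rewrite [LHS]big_split /=; congr (_ + _).
  by apply: eq_bigr => i _; rewrite subn0.
rewrite [LHS]big_nat_recl //.
rewrite [X in X + _]big_geq // add0r.
exact: (IH (fun j => F j.+1)).
Qed.

Lemma ssum_assoc s (G : seq nat -> seq nat -> seq nat -> K) :
  ssum s (fun p q => ssum p (fun p1 p2 => G p1 p2 q)) =
  ssum s (fun p q => ssum q (fun q1 q2 => G p q1 q2)).
Proof.
elim: s G => [|a s IH] G //=.
under eq_bigr do rewrite ssum_sum.
under [RHS]eq_bigr do rewrite ssum_sum.
under eq_bigr => i _ do under eq_bigr => j _ do
  rewrite (IH (fun p1 p2 q => G (j :: p1) ((i - j)%N :: p2) ((a - i)%N :: q))).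
exact: (sum_triangle a (fun i j k => ssum s (fun p q => ssum q
  (fun q1 q2 => G (i :: p) (j :: q1) (k :: q2))))).
Qed.

Lemma ssum_strip0l s (F : seq nat -> K) :
  ssum s (fun p q => if strip p == comp_nil then F q else 0) = F s.
Proof.
elim: s F => [|a s IH] F //=.
rewrite big_nat_recl // subn0 big1 ?addr0; last first.
  by move=> i _; rewrite ssumE big1.
exact: (IH (fun q => F (a :: q))).
Qed.

Lemma ssum_strip0r s (F : seq nat -> K) :
  ssum s (fun p q => if strip q == comp_nil then F p else 0) = F s.
Proof.
elim: s F => [|a s IH] F //=.
rewrite big_nat_recr //= subnn big_nat_cond big1 ?add0r; last first.
  move=> i /andP[/andP[_ ia] _]; rewrite ssumE big1 // => p _.
  by case: (a - i)%N (subn_gt0 i a) => //; rewrite ia.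
exact: (IH (fun q => F (a :: q))).
Qed.

Lemma mem_splits s p q :
  ((p, q) \in splits s) <->
  [/\ size p = size s, size q = size s
    & forall k, (nth 0 p k + nth 0 q k)%N = nth 0%N s k].
Proof.
elim: s p q => [|a s IH] p q; rewrite ?splits_cons.
  rewrite inE; split=> [/eqP[-> ->]|[/size0nil -> /size0nil ->]] //.
  by split=> // k; rewrite nth_nil.
split=> [/allpairsP[[i [p' q']] /= [ia /IH[sp sq e] [-> ->]]]|].
  split=> /=; rewrite ?sp ?sq // => -[|k] /=; last exact: e.
  by rewrite subnKC //; move: ia; rewrite mem_index_iota.
case: p q => [|i p] [|j q] [] // [sp] [sq] e.
apply/allpairsP; exists (i, (p, q)) => /=; have /= e0 := e 0%N; split.
- by rewrite mem_index_iota ltnS -e0 leq_addr.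
- by apply/IH; split=> // k; exact: (e k.+1).
- by rewrite -e0 addKn.
Qed.

Lemma uniq_splits s : uniq (splits s).
Proof.
elim: s => [|a s IH] //; rewrite splits_cons; apply: allpairs_uniq => //; first exact: iota_uniq.
by move=> [i [p q]] [j [p' q']] _ _ /= [-> -> _ ->].
Qed.

End SumOverSplittings.

Section PowerSeriesInT.
Context (K : fieldType).

(* K[[t]]: lc_coord f n is the coefficient of t^n in f. *)
Definition kt_mul (z : lc_tens (lc_prod K nat) (lc_prod K nat)) :
    lc_prod K nat :=
  fun n => \sum_(i < n.+1) z (val i, (n - i)%N).

Definition kt_one (c : lc_unit K) : lc_prod K nat :=
  fun n => (if n is 0%N then c else 0) : K.

Lemma kt_mul_map : lc_map kt_mul.
Proof.
split=> [a x y|].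
  apply/funext => n.
  change (\sum_(i < n.+1) (a * x (val i, (n - i)%N) + y (val i, (n - i)%N)) =
    a * (\sum_(i < n.+1) x (val i, (n - i)%N)) +
    \sum_(i < n.+1) y (val i, (n - i)%N)).
  by rewrite mulr_sumr -big_split.
apply: kpow_continuous => n; apply: kline_sum_continuous => i.
exact: kpow_proj_continuous.
Qed.

Lemma kt_one_map : lc_map kt_one.
Proof.
split=> [a x y|].
  by apply/funext => -[|n] //=; rewrite !fctE; exact: (esym (etrans (addr0 _) (mulr0 _))).
apply: kpow_continuous => -[|n]; first exact: id_continuous.
exact: kline_cst_continuous.
Qed.

Lemma kt_mulA (z : lc_tens (lc_tens (lc_prod K nat) (lc_prod K nat))
    (lc_prod K nat)) :
  kt_mul (lc_tmap kt_mul id z) = kt_mul (lc_tmap id kt_mul (lc_assoc z)).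
Proof.
apply/funext => n.
change (\sum_(i < n.+1) \sum_(j < i.+1) z ((val j, (i - j)%N), (n - i)%N) =
  \sum_(j < n.+1) \sum_(k < (n - j).+1) z ((val j, val k), (n - j - k)%N)).
have := sum_triangle n (fun j k l => z ((j, k), l)).
rewrite !big_mkord; under eq_bigr do rewrite big_mkord.
by under [X in _ = X -> _]eq_bigr do rewrite big_mkord.
Qed.

Lemma kt_mul1l (z : lc_tens (lc_unit K) (lc_prod K nat)) :
  kt_mul (lc_tmap kt_one id z) = lc_lunit z.
Proof.
apply/funext => n; rewrite /kt_mul big_ord_recl /= big1 ?addr0 //.
by rewrite /lc_tmap /= subn0.
Qed.

Lemma kt_mul1r (z : lc_tens (lc_prod K nat) (lc_unit K)) :
  kt_mul (lc_tmap id kt_one z) = lc_runit z.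
Proof.
apply/funext => n; rewrite /kt_mul big_ord_recr /= big1 ?add0r; last first.
  by move=> i _; rewrite /lc_tmap /=; case: (n - i)%N (subn_gt0 i n);
    rewrite ?ltn_ord.
by rewrite /lc_tmap /= subnn.
Qed.

Definition kt : lcAlgebra K :=
  LCAlgebra kt_mul_map kt_one_map kt_mulA kt_mul1l kt_mul1r.

End PowerSeriesInT.

Record lcCombCoalgebra (K : fieldType) := LCCombCoalgebra {
  cc_coalg :> lcCoalgebra K;
  cc_zeta : cc_coalg -> kt K;
  cc_zeta_map : lc_map cc_zeta;
  cc_zeta0 : forall v, lc_coord (cc_zeta v) 0%N = lc_counit v
}.

Record lcCombBialgebra (K : fieldType) := LCCombBialgebra {
  cb_bialg :> lcBialgebra K;
  cb_zeta : cb_bialg -> kt K;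
  cb_zeta_mor : lc_alg_mor cb_zeta;
  cb_zeta0 : forall v, lc_coord (cb_zeta v) 0%N = bi_counit v
}.

Definition cb_cc (K : fieldType) (V : lcCombBialgebra K) : lcCombCoalgebra K :=
  @LCCombCoalgebra K (bialg_coalg V) (@cb_zeta K V)
    (alg_mor_map (@cb_zeta_mor K V)) (@cb_zeta0 K V).

Definition lc_cc_mor (K : fieldType) (V W : lcCombCoalgebra K) (f : V -> W) :
    Prop :=
  lc_coalg_mor f /\ forall v, cc_zeta v = cc_zeta (f v).

(* lc_tpow V n is the (n + 1)-st completed tensor power, bracketed to the left;
   in lc_tpow_idx the entries a 0, ..., a n are read from left to right. *)
Fixpoint lc_tpow (K : fieldType) (V : lcSpace K) (n : nat) : lcSpace K :=
  if n is n'.+1 then lc_tens (lc_tpow V n') V else V.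

Fixpoint lc_tpow_map (K : fieldType) (V W : lcSpace K) (f : V -> W) (n : nat) :
    lc_tpow V n -> lc_tpow W n :=
  if n is n'.+1 then lc_tmap (lc_tpow_map f (n:=n')) f else f.

Fixpoint lc_tpow_idx (K : fieldType) (V : lcSpace K) (a : nat -> lc_idx V)
    (n : nat) : lc_idx (lc_tpow V n) :=
  if n is n'.+1 then (lc_tpow_idx a n', a n'.+1) else a 0%N.

Fixpoint lc_comul_iter (K : fieldType) (V : lcCoalgebra K) (n : nat) :
    V -> lc_tpow V n :=
  if n is n'.+1 then lc_tmap (@lc_comul_iter K V n') id \o @lc_comul K V
  else id.

Lemma lc_comul_iter1 (K : fieldType) (V : lcCoalgebra K) :
  @lc_comul_iter K V 1 = @lc_comul K V.
Proof. by rewrite /= lc_tmap_id. Qed.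
(* Exponents of the monomials in x_0, x_1, ... *)
Definition mon : Type := {fsfun nat -> nat with 0%N}.
HB.instance Definition _ := Choice.copy mon {fsfun nat -> nat with 0%N}.

Definition mon_val (m : mon) (k : nat) : nat :=
  (m : {fsfun nat -> nat with 0%N}) k.

(* The product of the x_(i_k)^(a_k), for i without repetition. *)
Definition xmon (i a : seq nat) : mon :=
  [fsfun k in [fset k in i]%fset => nth 0%N a (index k i) | 0%N].

Section PowerSeries.
Context {K : fieldType}.

(* K[[x_0, x_1, ...]], as functions giving the coefficient of each monomial. *)
Definition powser : Type := mon -> K.

Definition ps_mul (F G : powser) : powser := fun m =>
  \sum_(p \in [set p : mon * mon |
                forall k, (mon_val p.1 k + mon_val p.2 k)%N = mon_val m k])
     F p.1 * G p.2.

(* The monomial quasisymmetric function M_a, as a sum of monomials. *)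
Definition qs_M (a : composition) : powser := fun m =>
  \sum_(i \in [set i : seq nat | sorted ltn i /\ size i = size (val a)])
     ((m == xmon i (val a))%:R : K).

Definition mons (s : seq nat) : mon := xmon (iota 0 (size s)) s.

Lemma monP (m m' : mon) : mon_val m =1 mon_val m' -> m = m'.
Proof. by move=> e; apply/fsfunP. Qed.

Lemma xmonE i a k : (size a <= size i)%N ->
  mon_val (xmon i a) k = nth 0%N a (index k i).
Proof.
move=> ai; rewrite /mon_val /xmon fsfunE inE.
case: ifPn => // ki; rewrite nth_default //.
by rewrite (leq_trans ai) // leqNgt index_mem.
Qed.

Lemma monsE s k : mon_val (mons s) k = nth 0%N s k.
Proof.
rewrite xmonE ?size_iota //.
have [ks|ks] := ltnP k (size s).
  by rewrite -{1}(add0n k) -(nth_iota 0 0 ks) index_uniq ?size_iota ?iota_uniq.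
rewrite !nth_default // -[X in (X <= _)%N](size_iota 0 (size s)) leqNgt index_mem.
by rewrite mem_iota /= add0n -leqNgt.
Qed.

Lemma mons_surj (m : mon) : exists s, m = mons s.
Proof.
pose N := (\max_(k <- finsupp m) k.+1)%N.
exists (mkseq (mon_val m) N); apply: monP => k; rewrite monsE.
have [kN|kN] := ltnP k N; first by rewrite nth_mkseq.
rewrite nth_default ?size_mkseq //; apply: fsfun_dflt.
apply/negP => km; move: kN; rewrite leqNgt => /negP; apply.
by rewrite /N (big_rem k) //= leq_max ltnSn.
Qed.

Lemma qs_M_mons a s : qs_M a (mons s) = (a == strip s)%:R.
Proof.
pose I := [seq k <- iota 0 (size s) | (0 < nth 0 s k)%N].
have sI : map (nth 0%N s) I = val (strip s).
  by rewrite /= -[in RHS](mkseq_nth 0%N s) filter_map.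
have szI : size I = size (val (strip s)) by rewrite -sI size_map.
have srtI : sorted ltn I by apply: sorted_filter (iota_ltn_sorted _ _); exact: ltn_trans.
have key i : sorted ltn i /\ size i = size (val a) ->
    (mons s == xmon i (val a)) = (i == I) && (a == strip s).
  move=> [srti szi]; apply/eqP/andP => [e|[/eqP -> /eqP ->]]; last first.
    apply: monP => k; rewrite monsE xmonE ?szI // -sI.
    have [kI|kI] := boolP (k \in I).
      by rewrite (nth_map 0%N) ?index_mem // nth_index.
    rewrite [RHS]nth_default; last by rewrite size_map leqNgt index_mem.
    have [ks|ks] := ltnP k (size s); last by rewrite nth_default.
    by apply/eqP; move: kI; rewrite mem_filter mem_iota /= ks andbT -leqNgt leqn0.
  have ek k : nth 0%N s k = nth 0%N (val a) (index k i).
    by rewrite -monsE e xmonE ?szi.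
  have iI : i = I.
    apply: (irr_sorted_eq ltn_trans ltnn srti srtI) => k.
    rewrite mem_filter mem_iota /= add0n.
    have [ki|ki] := boolP (k \in i).
      have p : (0 < nth 0 s k)%N.
        rewrite ek; apply: (allP (valP a)); apply: mem_nth.
        by rewrite -szi index_mem.
      by rewrite p /=; apply/esym; apply: contraTT p; rewrite -!leqNgt => ?;
        rewrite nth_default.
    by rewrite ek nth_default // -szi leqNgt index_mem.
  split; first exact/eqP.
  apply/eqP/val_inj; rewrite -sI -iI.
  apply: (@eq_from_nth _ 0%N); first by rewrite size_map szi.
  move=> j ja; rewrite (nth_map 0%N) ?szi // ek index_uniq ?szi //.
  exact: (sorted_uniq ltn_trans ltnn srti).
rewrite /qs_M; have [as_|as_] := eqVneq a (strip s).
  rewrite -(@fsbig_widen _ _ _ _ [set I]).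
  - by rewrite fsbig_set1 key ?eqxx as_ ?eqxx //; split.
  - by move=> _ ->; rewrite /= as_; split.
  - by move=> i [Pi nI]; rewrite /= key //; case: eqP nI => // ->.
by rewrite fsbig1 // => i Pi; rewrite key // (negPf as_) andbF.
Qed.

Lemma ps_mul_mons F G s :
  ps_mul F G (mons s) = ssum s (fun p q => F (mons p) * G (mons q)).
Proof.
pose h (p : seq nat * seq nat) := (mons p.1, mons p.2).
have inj : {in splits s &, injective h}.
  move=> [p q] [p' q'] /mem_splits[sp sq _] /mem_splits[sp' sq' _] [e1 e2].
  congr (_, _); apply: (@eq_from_nth _ 0%N); rewrite ?sp ?sp' ?sq ?sq' // => k _.
    by rewrite -!monsE e1.
  by rewrite -!monsE e2.
rewrite ssumE -[RHS](big_map h xpredT (fun p => F p.1 * G p.2)).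
rewrite [RHS]fsbig_seq; last by rewrite map_inj_in_uniq ?uniq_splits.
apply: eq_fsbigl; apply/seteqP; split=> [[m1 m2] /= e|_ /= /mapP[[p q] pq ->]].
  apply/mapP; exists (mkseq (mon_val m1) (size s), mkseq (mon_val m2) (size s)).
    apply/mem_splits; rewrite !size_mkseq; split=> // k.
    have [ks|ks] := ltnP k (size s); first by rewrite !nth_mkseq // e monsE.
    by rewrite !nth_default ?size_mkseq.
  have z k : (size s <= k)%N -> mon_val m1 k = 0%N /\ mon_val m2 k = 0%N.
    move=> ks; have := e k; rewrite monsE nth_default // => /eqP.
    by rewrite addn_eq0 => /andP[/eqP -> /eqP ->].
  by congr (_, _); apply: monP => k /=; rewrite monsE;
    (have [ks|ks] := ltnP k (size s); first by rewrite nth_mkseq);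
    rewrite nth_default ?size_mkseq //; case: (z _ ks).
move=> k; rewrite !monsE.
by have [_ _ ->] := (mem_splits _ _ _).1 pq.
Qed.

End PowerSeries.

Arguments powser : clear implicits.

Section QSym.
Context (K : fieldType).

(* The linearly compact space with pseudobasis indexed by compositions; its
   elements are identified with power series by qs_series below. *)
Definition qs_space : lcSpace K := lc_prod K composition.

Definition qs_series (F : qs_space) : powser K := fun m =>
  \sum_(a \in [set: composition]) F a * qs_M a m.

Definition qs_basis (a : composition) : qs_space := fun b => (b == a)%:R.

(* The product of power series, extended to the completed tensor product; the
   coefficient of M_c in a quasisymmetric power series is its coefficient at
   the monomial x_0^(c_0) x_1^(c_1) ... (see qs_series_mul). *)
Definition qs_mul (z : lc_tens qs_space qs_space) : qs_space := fun c =>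
  \sum_(p \in [set: composition * composition])
     z p * ps_mul (qs_M p.1) (qs_M p.2) (mons (val c)).

Definition qs_one (u : lc_unit K) : qs_space :=
  fun a => if a == comp_nil then u : K else 0.

(* Deconcatenation (see qs_comul_basis). *)
Definition qs_comul (F : qs_space) : lc_tens qs_space qs_space :=
  fun p => F (comp_cat p.1 p.2).

Definition qs_counit (F : qs_space) : lc_unit K := F comp_nil.

(* M_[::] |-> 1, M_[:: n] |-> t^n for n > 0, and M_a |-> 0 otherwise. *)
Definition qs_zeta (F : qs_space) : kt K := fun n => F (strip [:: n]).

Lemma strip_val (a : composition) : strip (val a) = a.
Proof. by apply: val_inj; apply/all_filterP; exact: valP. Qed.

Lemma strip_cat s t : strip (s ++ t) = comp_cat (strip s) (strip t).
Proof. by apply: val_inj; rewrite /= filter_cat. Qed.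

Lemma strip_nil : strip [::] = comp_nil.
Proof. exact: val_inj. Qed.

Lemma qs_series_mons F s : qs_series F (mons s) = F (strip s).
Proof.
rewrite /qs_series -(@fsbig_widen _ _ _ _ [set strip s]) //.
  by rewrite fsbig_set1 qs_M_mons eqxx mulr1.
move=> a [_ /= as_]; rewrite qs_M_mons; case: eqP as_ => // _ _.
by rewrite mulr0.
Qed.

Lemma qs_series_inj : injective qs_series.
Proof.
move=> F G e; apply/funext => a.
by rewrite -(strip_val a) -!qs_series_mons e.
Qed.

Lemma qs_series_basis a : qs_series (qs_basis a) = qs_M a.
Proof.
apply/funext => m; have [s ->] := mons_surj m.
by rewrite qs_series_mons qs_M_mons /qs_basis eq_sym.
Qed.

Lemma qs_mulE z c :
  qs_mul z c = ssum (val c) (fun p q => z (strip p, strip q)).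
Proof.
pose h (p : seq nat * seq nat) := (strip p.1, strip p.2).
pose r := undup (map h (splits (val c))).
have e ab : ps_mul (qs_M ab.1) (qs_M ab.2) (mons (val c)) =
    \sum_(p <- splits (val c)) (ab == h p)%:R :> K.
  rewrite ps_mul_mons ssumE; apply: eq_bigr => -[p q] _.
  by rewrite !qs_M_mons -natrM mulnb /h; case: ab.
rewrite /qs_mul -(@fsbig_widen _ _ _ _ [set` r]) //; last first.
  move=> ab [_ /= abr]; rewrite e big_seq big1 ?mulr0 // => p pc.
  case: eqP => // abp; case: abr; rewrite abp mem_undup; exact: map_f.
rewrite -fsbig_seq ?undup_uniq // ssumE.
under eq_bigr do rewrite e mulr_sumr.
rewrite exchange_big /= big_seq [RHS]big_seq; apply: eq_bigr => p pc.
rewrite (bigD1_seq (h p)) ?undup_uniq //=; last by rewrite mem_undup map_f.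
rewrite eqxx mulr1 big1 ?addr0 // => ab /negPf ->.
by rewrite mulr0.
Qed.

Lemma ssum_strip s (z : composition -> composition -> K) :
  ssum (val (strip s)) (fun p q => z (strip p) (strip q)) =
  ssum s (fun p q => z (strip p) (strip q)).
Proof.
pose H x y := z (strip x) (strip y).
have sf x : strip (seq.filter (leq 1) x) = strip x.
  by apply: val_inj; rewrite /= filter_id.
have e t : ssum t (fun p q => z (strip p) (strip q)) =
    ssum t (fun p q => H (seq.filter (leq 1) p) (seq.filter (leq 1) q)).
  by apply: eq_ssum => p q; rewrite /H !sf.
by rewrite !e -ssum_filter.
Qed.

Lemma qs_series_mul F G :
  qs_series (qs_mul (lc_pure F G)) = ps_mul (qs_series F) (qs_series G).
Proof.
apply/funext => m; have [s ->] := mons_surj m.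
rewrite qs_series_mons qs_mulE ps_mul_mons.
rewrite (ssum_strip s (fun a b => F a * G b)).
by apply: eq_ssum => p q; rewrite !qs_series_mons.
Qed.

Lemma qs_mul_map : lc_map qs_mul.
Proof.
split=> [a x y|].
  apply/funext => c.
  change (qs_mul (a *: x + y) c = a * qs_mul x c + qs_mul y c).
  by rewrite !qs_mulE !ssumE mulr_sumr -big_split.
apply: kpow_continuous => c.
rewrite (_ : (fun z => _) = (fun z : lc_tens qs_space qs_space =>
    \sum_(p <- splits (val c)) z (strip p.1, strip p.2) : kline K)).
  by apply: kline_sum_continuous => p; exact: kpow_proj_continuous.
by apply/funext => z; rewrite qs_mulE ssumE.
Qed.

Lemma qs_one_map : lc_map qs_one.
Proof.
split=> [a x y|].
  apply/funext => c.
  rewrite -[RHS]/(a * (qs_one x c : K) + (qs_one y c : K)) /qs_one.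
  case: (c == comp_nil) => //.
  by rewrite (mulr0 a) (addr0 (0 : K)).
apply: kpow_continuous => c; rewrite /qs_one; case: (c == comp_nil).
  exact: id_continuous.
exact: kline_cst_continuous.
Qed.

Lemma qs_comul_map : lc_map qs_comul.
Proof.
split=> //; apply: kpow_continuous => p; exact: kpow_proj_continuous.
Qed.

Lemma qs_counit_map : lc_map qs_counit.
Proof. by split=> //; exact: kpow_proj_continuous. Qed.

Lemma qs_zeta_map : lc_map qs_zeta.
Proof.
by split=> //; apply: kpow_continuous => n; exact: kpow_proj_continuous.
Qed.

Lemma comp_catA a b c : comp_cat (comp_cat a b) c = comp_cat a (comp_cat b c).
Proof. by apply: val_inj; rewrite /= catA. Qed.

Lemma comp_cat0 a : comp_cat a comp_nil = a.
Proof. by apply: val_inj; rewrite /= cats0. Qed.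

Lemma comp_0cat a : comp_cat comp_nil a = a.
Proof. exact: val_inj. Qed.

Lemma comp_cat_eq0 a b :
  (comp_cat a b == comp_nil) = (a == comp_nil) && (b == comp_nil).
Proof. by rewrite -!val_eqE /=; case: (val a). Qed.

Lemma qs_comul_basis a :
  qs_comul (qs_basis a) =
  \sum_(i < (size (val a)).+1)
     lc_pure (qs_basis (strip (take i (val a))))
             (qs_basis (strip (drop i (val a)))).
Proof.
apply/funext => -[b c].
rewrite (big_morph (fun F : kpow K (composition * composition) => F (b, c) : K)
  (id1 := 0) (op1 := +%R)) //.
have st s : all (leq 1) s -> val (strip s) = s by move/all_filterP.
have at_ i : all (leq 1) (take i (val a)).
  by have := valP a; rewrite -{1}(cat_take_drop i (val a)) all_cat => /andP[].
have ad i : all (leq 1) (drop i (val a)).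
  by have := valP a; rewrite -{1}(cat_take_drop i (val a)) all_cat => /andP[].
rewrite /qs_comul /lc_pure /qs_basis /=.
have [ea|ne] := eqVneq (comp_cat b c) a.
  rewrite -{}ea in at_ ad *.
  have sb : (size (val b) < (size (val (comp_cat b c))).+1)%N.
    by rewrite /= size_cat ltnS leq_addr.
  rewrite (bigD1 (Ordinal sb)) //= take_size_cat // drop_size_cat //.
  rewrite !strip_val !eqxx mulr1 big1 ?addr0 // => i ib.
  case: eqP => [e|_]; last by rewrite mul0r.
  case/negP: ib; apply/eqP/val_inj => /=.
  have /(congr1 (size \o val)) /= := e; rewrite (all_filterP (at_ i)) /= => ->.
  by rewrite size_takel // -ltnS.
rewrite big1 // => i _; case: eqP => [eb|_]; last by rewrite mul0r.
case: eqP => [ec|_]; last by rewrite mulr0.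
case/eqP: ne; apply: val_inj; rewrite -[LHS]/(val b ++ val c) eb ec.
by rewrite (st _ (at_ i)) (st _ (ad i)) cat_take_drop.
Qed.

Lemma qs_mulA (z : lc_tens (lc_tens qs_space qs_space) qs_space) :
  qs_mul (lc_tmap qs_mul id z) = qs_mul (lc_tmap id qs_mul (lc_assoc z)).
Proof.
apply/funext => c; rewrite !qs_mulE.
under eq_ssum => p q.
  rewrite /lc_tmap /= qs_mulE.
  rewrite (ssum_strip p (fun a b => z ((a, b), strip q))).
  over.
under [RHS]eq_ssum => p q.
  rewrite /lc_tmap /= qs_mulE.
  rewrite (ssum_strip q (fun a b => z ((strip p, a), b))).
  over.
exact: (ssum_assoc (val c) (fun p q r => z ((strip p, strip q), strip r))).
Qed.

Lemma qs_mul1l (z : lc_tens (lc_unit K) qs_space) :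
  qs_mul (lc_tmap qs_one id z) = lc_lunit z.
Proof.
apply/funext => c; rewrite qs_mulE.
rewrite -[in RHS](strip_val c).
exact: (ssum_strip0l (val c) (fun q => z (tt, strip q))).
Qed.

Lemma qs_mul1r (z : lc_tens qs_space (lc_unit K)) :
  qs_mul (lc_tmap id qs_one z) = lc_runit z.
Proof.
apply/funext => c; rewrite qs_mulE.
rewrite -[in RHS](strip_val c).
exact: (ssum_strip0r (val c) (fun q => z (strip q, tt))).
Qed.

Definition qs_alg : lcAlgebra K :=
  LCAlgebra qs_mul_map qs_one_map qs_mulA qs_mul1l qs_mul1r.

Lemma qs_comulA (v : qs_space) :
  lc_assoc (lc_tmap qs_comul id (qs_comul v)) =
  lc_tmap id qs_comul (qs_comul v).
Proof.
apply/funext => -[a [b c]].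
by rewrite /lc_assoc /lc_tmap /= /qs_comul /= comp_catA.
Qed.

Lemma qs_counitl (v : qs_space) :
  lc_lunit (lc_tmap qs_counit id (qs_comul v)) = v.
Proof.
apply/funext => a.
by rewrite /lc_lunit /lc_tmap /= /qs_counit /qs_comul /= comp_0cat.
Qed.

Lemma qs_counitr (v : qs_space) :
  lc_runit (lc_tmap id qs_counit (qs_comul v)) = v.
Proof.
apply/funext => a.
by rewrite /lc_runit /lc_tmap /= /qs_counit /qs_comul /= comp_cat0.
Qed.

Lemma qs_comulM (z : lc_tens qs_space qs_space) :
  qs_comul (qs_mul z) =
  lc_tmap qs_mul qs_mul (lc_mid4 (lc_tmap qs_comul qs_comul z)).
Proof.
apply/funext => -[a b].
rewrite /qs_comul /= qs_mulE /= ssum_cat /lc_tmap /= qs_mulE.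
apply: eq_ssum => p q; rewrite qs_mulE; apply: eq_ssum => p' q'.
by rewrite !strip_cat.
Qed.

Lemma qs_comul1 (c : lc_unit K) :
  qs_comul (qs_one c) =
  lc_tmap qs_one qs_one (lc_pure c ((1 : K) : lc_unit K)).
Proof.
apply/funext => -[a b].
rewrite /qs_comul /lc_tmap /lc_pure /qs_one /= comp_cat_eq0.
by case: eqP => //= _; case: eqP => //= _; rewrite mulr1.
Qed.

Lemma qs_counitM (z : lc_tens qs_space qs_space) :
  qs_counit (qs_mul z) = lc_lunit (lc_tmap qs_counit qs_counit z).
Proof.
by rewrite /qs_counit qs_mulE /= strip_nil.
Qed.

Lemma qs_counit1 (c : lc_unit K) : qs_counit (qs_one c) = c.
Proof. by rewrite /qs_counit /qs_one eqxx. Qed.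

Definition qs_bialg : lcBialgebra K :=
  @LCBialgebra K qs_alg qs_comul qs_counit qs_comul_map qs_counit_map
    qs_comulA qs_counitl qs_counitr qs_comulM qs_comul1 qs_counitM qs_counit1.

Lemma qs_zeta_mor : @lc_alg_mor K qs_alg (kt K) qs_zeta.
Proof.
split; first exact: qs_zeta_map.
  move=> z; apply/funext => n.
  change (qs_mul z (strip [:: n]) =
    \sum_(i < n.+1) z (strip [:: val i], strip [:: (n - i)%N])).
  rewrite qs_mulE (ssum_strip [:: n] (fun a b => z (a, b))) /=.
  by rewrite big_mkord.
move=> c; apply/funext => -[|n] //.
Qed.

Lemma qs_zeta0 (v : qs_space) : lc_coord (qs_zeta v) 0%N = qs_counit v.
Proof. by rewrite /= /qs_zeta /qs_counit -strip_nil; congr v; exact: val_inj. Qed.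

Definition QSym : lcCombBialgebra K :=
  @LCCombBialgebra K qs_bialg qs_zeta qs_zeta_mor qs_zeta0.

End QSym.

(* zeta_a; for a nonempty of size m, lc_comul_iter V m.-1 is the iterated
   coproduct Delta^(m-1). *)
Definition zeta_comp (K : fieldType) (V : lcCombCoalgebra K) (a : composition)
    (v : V) : K :=
  let m := size (val a) in
  if m is 0%N then lc_coord (cc_zeta v) 0%N
  else lc_coord (lc_tpow_map (@cc_zeta K V) (lc_comul_iter m.-1 v))
         (lc_tpow_idx (V := kt K) (nth 0%N (val a)) m.-1).

Definition psi (K : fieldType) (V : lcCombCoalgebra K) (v : V) :
    cb_cc (QSym K) :=
  lc_sum (fun a : lc_idx (cb_cc (QSym K)) => zeta_comp a v).

(* Main.v *)
Require Import Defs.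
From mathcomp Require Import all_boot all_algebra.
From mathcomp Require Import all_classical topology.

Set Implicit Arguments.
Unset Strict Implicit.
Unset Printing Implicit Defensive.

Import GRing.Theory.
Local Open Scope classical_set_scope.
Local Open Scope ring_scope.

(** The discrete field of scalars forces every continuous linear functional on a
product of lines to depend on finitely many coordinates
([functional_lc_map]).  Functionals on V thus behave as the vectors of the
discrete dual of V: they have a tensor product [tens], compatible with
completed tensor products of maps ([tens_tmap]) and with the interchange of
factors ([tens_mid4]), and the coproduct of V turns them into an associative
algebra for the convolution [conv], with unit the counit of V.  The
finiteness is what makes this more than formal manipulation: it is what allows
a functional to be exchanged with a linear map, or with another functional,
inside an infinite sum.

Write zeta_n for the coefficient of t^n in zeta.  The coefficient zeta_a of the
theorem is the convolution zeta_(a_1) * ... * zeta_(a_m) ([zeta_compE]), in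
other words the image of a word under the algebra morphism from the free
algebra on the letters n > 0 to the dual of V; that free algebra is dual to
QSym.  Since zeta_0 is the counit, letters 0 may be inserted or erased at will,
so that words over all of nat can be used.

The claims become statements about words.  Compatibility of psi with
coproducts says that the functional of a concatenation is the convolution of
the functionals.  Conversely, a morphism phi has prescribed coefficients on
words of length one, by compatibility with zeta, hence on all words, by
compatibility with coproducts and induction on the length.  Finally, if V is a
bialgebra with zeta multiplicative, then zeta_n (x y) is the sum of the
zeta_i x * zeta_(n-i) y; because the coproduct is multiplicative, this formula
propagates from letters to words ([zeta_word_mul]), and the result is the
quasi-shuffle formula for the coefficients of a product of quasisymmetric
functions. *)

(** * Finite linear combinations in linearly compact spaces *)

Section LinearCombinations.
Context {K : fieldType}.
Implicit Types V W : lcSpace K.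

Lemma linear_comb V W (f : V -> W) (J : Type) (r : seq J) (c : J -> K)
    (x : J -> V) : linear f ->
  f (\sum_(k <- r) c k *: x k) = \sum_(k <- r) c k *: f (x k).
Proof.
move=> lf; elim: r => [|k r IH]; last by rewrite !big_cons lf IH.
rewrite !big_nil; have := lf (- 1) 0 0.
by rewrite addr0 scaler0 scaleN1r addrC subrr.
Qed.

Lemma lc_coord_comb V (J : Type) (r : seq J) (c : J -> K) (x : J -> V) i :
  lc_coord (\sum_(k <- r) c k *: x k) i = \sum_(k <- r) c k * lc_coord (x k) i.
Proof.
elim: r => [|k r IH]; last by rewrite !big_cons lc_coord_linear -IH.
by rewrite !big_nil -(scale0r (0 : V)) lc_coordZ mul0r.
Qed.

Lemma lc_sum_comb V (J : Type) (r : seq J) (c : J -> K)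
    (x : J -> lc_idx V -> K) :
  lc_sum (fun i => \sum_(k <- r) c k * x k i) =
  \sum_(k <- r) c k *: lc_sum (x k) :> V.
Proof.
apply: (can_inj (@lc_coordK K V)); apply/funext => i.
by rewrite lc_coord_comb lc_sumK; apply: eq_bigr => k _; rewrite lc_sumK.
Qed.

Lemma lc_tmap_linear V W V' W' (f : V -> V') (g : W -> W') :
  linear f -> linear g -> linear (lc_tmap f g).
Proof.
move=> lf lg a x y; apply/funext => -[i j].
rewrite -[RHS]/(a * lc_tmap f g x (i, j) + lc_tmap f g y (i, j)) /lc_tmap /=.
rewrite -[X in _ = X]/((a *: lc_coord (f _) + lc_coord (f _)) i).
rewrite -lc_coord_linear -lf -lc_sum_linear; congr (lc_coord (f (lc_sum _)) i).
apply/funext => k.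
rewrite -[RHS]/((a *: lc_coord (g _) + lc_coord (g _)) j).
by rewrite -lc_coord_linear -lg -lc_sum_linear.
Qed.

End LinearCombinations.

(** * Continuous linear functionals *)

Section Functionals.
Context {K : fieldType}.
Implicit Types V W : lcSpace K.

(** The continuous linear functionals, in the algebraic form used below: see
[functional_lc_map] and [functional_continuous] for the link with the topology.
A list of terms is used, possibly with repetitions, because the index type of
a pseudobasis has no decidable equality. *)
Definition functional V (f : V -> K) : Prop :=
  exists r : seq (K * lc_idx V),
    forall v, f v = \sum_(p <- r) p.1 * lc_coord v p.2.

Lemma functional_comb V (f : V -> K) (J : Type) (r : seq J) (c : J -> K)
    (x : J -> V) : functional f ->
  f (\sum_(k <- r) c k *: x k) = \sum_(k <- r) c k * f (x k).
Proof.
move=> [s fE]; rewrite fE.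
under eq_bigr do rewrite lc_coord_comb mulr_sumr.
rewrite exchange_big /=; apply: eq_bigr => k _; rewrite fE mulr_sumr.
by apply: eq_bigr => p _; rewrite mulrCA.
Qed.

Lemma functional_linear V (f : V -> K) :
  functional f -> linear (f : V -> lc_unit K).
Proof.
move=> [r fE] a x y; rewrite -[RHS]/(a * f x + f y) !fE mulr_sumr -big_split.
by apply: eq_bigr => p _; rewrite lc_coord_linear mulrDr mulrCA.
Qed.

Lemma functional_sum V (J : Type) (r : seq J) (c : J -> K) (f : J -> V -> K) :
  (forall k, functional (f k)) ->
  functional (fun v => \sum_(k <- r) c k * f k v).
Proof.
move=> ff; elim: r => [|k r [s sE]].
  by exists [::] => v; rewrite !big_nil.
have [t tE] := ff k.
exists ([seq (c k * p.1, p.2) | p <- t] ++ s) => v.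
rewrite big_cons sE big_cat big_map tE mulr_sumr.
by congr (_ + _); apply: eq_bigr => p _; rewrite mulrA.
Qed.

Lemma functional_coord V i : functional (fun v : V => lc_coord v i).
Proof. by exists [:: (1, i)] => v; rewrite big_seq1 mul1r. Qed.

Lemma functional_continuous V (f : V -> K) :
  functional f -> continuous (f : V -> kline K).
Proof.
move=> [r fE]; rewrite (_ : f = (fun v => \sum_(p <- r) p.1 * lc_coord v p.2));
  last exact/funext.
apply: kline_sum_continuous => p.
apply: (@kline_op2_continuous K V *%R); first exact: kline_cst_continuous.
move=> v; apply: (@continuous_comp _ _ _ (@lc_coord K V)
  (fun c : kpow K (lc_idx V) => c p.2 : kline K)).
  exact: lc_coord_continuous.
exact: kpow_proj_continuous.
Qed.

(** The sets satisfying the conclusion form a filter, and this filter converges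
to 0 because it does so along each coordinate; the product topology therefore
need not be unfolded into basic open sets. *)
Lemma kpow_nbhs0 (I : Type) (A : set (kpow K I)) : nbhs (0 : kpow K I) A ->
  exists r : seq I, forall z : kpow K I,
    all (fun i => z i == 0) r -> A z.
Proof.
pose G : set_system (kpow K I) := [set B | exists r : seq I,
  forall z : kpow K I, all (fun i => z i == 0) r -> B z].
have fG : Filter G.
  split.
  - by exists [::].
  - move=> B C [r Br] [s Cs]; exists (r ++ s) => z.
    by rewrite all_cat => /andP[/Br Bz /Cs Cz]; split.
  - by move=> B C sBC [r Br]; exists r => z /Br /sBC.
suff G0 : G --> (0 : kpow K I) by move=> /G0.
apply/cvg_sup => i B [_ [[C Cop <-] C0] sCB].
by exists [:: i] => z /= /andP[/eqP zi _]; apply: sCB; rewrite /= zi.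
Qed.

(** Since the point 0 is open in K, a continuous functional vanishes on a
neighbourhood of 0, hence depends on the coordinates in a finite list only.
Induction on this list removes one coordinate at a time: if i is its head,
then z |-> g (z - z_i e_i) depends on the tail only. *)
Lemma functional_lc_map V (f : V -> lc_unit K) : lc_map f -> functional f.
Proof.
move=> [lf cf]; pose g (c : kpow K (lc_idx V)) : K := f (lc_sum c).
have lg : forall a x y, g (a *: x + y) = a * g x + g y.
  by move=> a x y; rewrite /g lc_sum_linear lf.
have g0 : g 0 = 0 by have := lg (- 1) 0 0; rewrite addr0 scaler0 mulN1r addNr.
suff [r gr] : exists r : seq (K * lc_idx V),
    forall z, g z = \sum_(p <- r) p.1 * z p.2.
  by exists r => v; rewrite -gr /g lc_coordK.
have [r] : exists r : seq (lc_idx V), forall z : kpow K (lc_idx V),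
    all (fun i => z i == 0) r -> g z = 0.
  apply: kpow_nbhs0.
  have cg : continuous (g : kpow K (lc_idx V) -> kline K).
    move=> x; apply: (@continuous_comp _ _ _ (@lc_sum K V) f).
      exact: lc_sum_continuous.
    exact: cf.
  apply: (cg 0 [set y | y = 0]); rewrite g0.
  exact: (@discrete_set1 (discrete_topology K)).
elim: r (g) lg {g0} => [|i r IH] h lh h0.
  by exists [::] => z; rewrite big_nil h0.
pose e : kpow K (lc_idx V) := fun j => `[< j = i >]%:R.
pose h' (z : kpow K (lc_idx V)) := h (- z i *: e + z).
have [|z z0|s sE] := IH h'.
- move=> a x y; rewrite /h' -!lh; congr h.
  apply/funext => j.
  rewrite -[LHS]/(- (a * x i + y i) * e j + (a * x j + y j)).
  rewrite -[RHS]/(a * (- x i * e j + x j) + (- y i * e j + y j)).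
  by rewrite mulrDr opprD mulrDl -!addrA mulrA mulrN; congr (_ + _);
    rewrite addrCA.
- have h'0 j : z j == 0 -> (- z i *: e + z) j == 0.
    rewrite -[(- z i *: e + z) j]/(- z i * e j + z j) /e => /eqP zj.
    case: asboolP => [ji|_]; first by rewrite -ji zj mulr1 addNr.
    by rewrite mulr0 add0r zj.
  apply: h0; rewrite /= (sub_all h'0 z0) andbT.
  rewrite -[(- z i *: e + z) i]/(- z i * e i + z i) /e.
  by case: asboolP => // _; rewrite mulr1 addNr.
exists ((h e, i) :: s) => z; rewrite big_cons -sE /h' lh /=.
by rewrite addrA mulNr [h e * _]mulrC subrr add0r.
Qed.

Lemma functional_comp V W (f : V -> W) (l : W -> K) :
  lc_map f -> functional l -> functional (l \o f).
Proof.
move=> [lf cf] [r lE].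
rewrite (_ : l \o f = fun v => \sum_(p <- r) p.1 * lc_coord (f v) p.2); last first.
  by apply/funext => v; rewrite /= lE.
apply: functional_sum => p; apply: functional_lc_map; split.
  by move=> a x y; rewrite lf lc_coord_linear.
move=> v; apply: (@continuous_comp _ _ _ f (fun w : W => lc_coord w p.2 : kline K)).
  exact: cf.
exact: (functional_continuous (functional_coord p.2)).
Qed.

End Functionals.

(** * Tensor products of functionals *)

Section TensorOfFunctionals.
Context {K : fieldType}.
Implicit Types U V W : lcSpace K.

(** The functional l tensor m on the completed tensor product; it is by
definition a coefficient of [lc_tmap] when l and m are coefficients of two
maps. *)
Definition tens V W (l : V -> K) (m : W -> K) (z : lc_tens V W) : K :=
  l (lc_sum (fun i => m (lc_sum (fun j => z (i, j))))).

Lemma tensE V W (l : V -> K) (m : W -> K) rl rm z :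
  (forall v, l v = \sum_(p <- rl) p.1 * lc_coord v p.2) ->
  (forall w, m w = \sum_(q <- rm) q.1 * lc_coord w q.2) ->
  tens l m z = \sum_(p <- rl) p.1 * \sum_(q <- rm) q.1 * z (p.2, q.2).
Proof.
move=> lE mE; rewrite /tens lE; apply: eq_bigr => p _; rewrite lc_sumK mE.
by congr (_ * _); apply: eq_bigr => q _; rewrite lc_sumK.
Qed.

Lemma functional_tens V W (l : V -> K) (m : W -> K) :
  functional l -> functional m -> functional (tens l m).
Proof.
move=> [rl lE] [rm mE].
rewrite (_ : tens l m = fun z => \sum_(p <- rl) p.1 *
    \sum_(q <- rm) q.1 * lc_coord z (p.2, q.2)); last first.
  by apply/funext => z; exact: tensE.
by do 2! [apply: functional_sum => ?]; exact: functional_coord.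
Qed.

(** The functional m has to be moved past the infinite sum to which f is
applied; as m is a finite combination of coordinates, linearity of f is enough
for this. *)
Lemma tens_tmap V W V' W' (f : V -> V') (g : W -> W') (l : V' -> K)
    (m : W' -> K) z :
  linear f -> functional m ->
  tens l m (lc_tmap f g z) = tens (l \o f) (m \o g) z.
Proof.
move=> lf [r mE]; rewrite /tens /=; congr l.
under eq_fun do rewrite mE.
under [in RHS]eq_fun do rewrite mE.
rewrite [in RHS]lc_sum_comb (linear_comb _ _ _ lf) -[RHS]lc_coordK.
congr lc_sum; apply/funext => i; rewrite lc_coord_comb.
by apply: eq_bigr => p _; rewrite lc_sumK.
Qed.

(** A Fubini theorem for infinite sums: expanding l into its finitely many
coordinates leaves only the linearity of m. *)
Lemma functional_exchange V W (l : V -> K) (m : W -> K)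
    (z : lc_idx V -> lc_idx W -> K) :
  functional l -> functional m ->
  l (lc_sum (fun i => m (lc_sum (fun j => z i j)))) =
  m (lc_sum (fun j => l (lc_sum (fun i => z i j)))).
Proof.
move=> [rl lE] fm; rewrite lE.
under [in RHS]eq_fun do rewrite lE.
rewrite lc_sum_comb functional_comb //; apply: eq_bigr => p _.
rewrite lc_sumK; congr (_ * m (lc_sum _)).
by apply/funext => j; rewrite lc_sumK.
Qed.

(** Both sides evaluate k, l and m on nested slices of z in the same order. *)
Lemma tens_assoc U V W (k : U -> K) (l : V -> K) (m : W -> K) z :
  tens (tens k l) m z = tens k (tens l m) (lc_assoc z).
Proof. by []. Qed.

(** Here the slices are nested in a different order on the two sides: b and c
have to be exchanged. *)
Lemma tens_mid4 (A B C D : lcSpace K) (a : A -> K) (b : B -> K) (c : C -> K)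
    (d : D -> K) z :
  functional b -> functional c ->
  tens (V:=lc_tens A C) (W:=lc_tens B D) (tens a c) (tens b d) (lc_mid4 z) =
  tens (tens a b) (tens c d) z.
Proof.
move=> fb fc; rewrite /tens /=; congr (a (lc_sum _)); apply/funext => i.
exact: (functional_exchange (fun k j => d (lc_sum (fun l => z ((i, j), (k, l))))) fc fb).
Qed.

Lemma tens_sum V W (I J : Type) (r : seq I) (s : seq J) (l : I -> V -> K)
    (m : J -> W -> K) z :
  (forall i, functional (l i)) ->
  tens (fun v => \sum_(i <- r) l i v) (fun w => \sum_(j <- s) m j w) z =
  \sum_(i <- r) \sum_(j <- s) tens (l i) (m j) z.
Proof.
move=> fl; rewrite /tens; apply: eq_bigr => i _.
under eq_fun do under eq_bigr do rewrite -[m _ _]mul1r.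
by rewrite lc_sum_comb functional_comb //; apply: eq_bigr => j _; rewrite mul1r.
Qed.

Lemma tens_pure V W (l : V -> K) (m : W -> K) v w :
  functional l -> functional m -> tens l m (lc_pure v w) = l v * m w.
Proof.
move=> fl fm.
exact: (congr1 (fun z : lc_tens (lc_unit K) (lc_unit K) => z (tt, tt))
  (lc_tmap_pure (W' := lc_unit K) (V' := lc_unit K) v w
    (functional_linear fl) (functional_linear fm))).
Qed.

End TensorOfFunctionals.

(** * The convolution algebra of a coalgebra *)

Section Convolution.
Context {K : fieldType} (V : lcCoalgebra K).
Implicit Types l m n : V -> K.

Definition conv l m (v : V) : K := tens l m (lc_comul v).

Lemma functional_counit : functional (@lc_counit K V).
Proof. by apply: functional_lc_map; exact: lc_counit_map. Qed.

Lemma functional_conv l m : functional l -> functional m -> functional (conv l m).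
Proof.
by move=> fl fm; apply: (functional_comp (lc_comul_map V)); exact: functional_tens.
Qed.

Lemma convA l m n : functional l -> functional m -> functional n ->
  conv l (conv m n) = conv (conv l m) n.
Proof.
move=> fl fm fn; apply/funext => v; rewrite /conv.
have [lD _] := lc_comul_map V.
transitivity (tens l (tens m n) (lc_tmap id (@lc_comul K V) (lc_comul v))).
  by rewrite tens_tmap //; exact: functional_tens.
by rewrite -lc_comulA -tens_assoc tens_tmap.
Qed.

Lemma conv1l l : functional l -> conv (@lc_counit K V) l = l.
Proof.
move=> fl; apply/funext => v; rewrite -[in RHS](lc_counitl v).
have [le _] := lc_counit_map V.
rewrite -[RHS]/(tens (V := lc_unit K) id l _) tens_tmap //.
Qed.

Lemma conv1r l : functional l -> conv l (@lc_counit K V) = l.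
Proof.
move=> fl; apply/funext => v; rewrite -[in RHS](lc_counitr v).
rewrite -[RHS]/(tens (W := lc_unit K) l id _) tens_tmap //.
by exists [:: (1, tt)] => c; rewrite big_seq1 mul1r.
Qed.

End Convolution.

(** * The universal morphism of a combinatorial coalgebra *)

Section WordFunctionals.
Context {K : fieldType} (V : lcCombCoalgebra K).

Definition zeta_coef (n : nat) (v : V) : K := lc_coord (cc_zeta v) n.

Definition zeta_word (s : seq nat) : V -> K :=
  foldr (fun n f => conv (zeta_coef n) f) (@lc_counit K V) s.

Lemma functional_zeta_coef n : functional (zeta_coef n).
Proof.
exact: (functional_comp (cc_zeta_map V) (functional_coord (V := kt K) n)).
Qed.

(** The reason why letters 0 are invisible in words. *)
Lemma zeta_coef0 : zeta_coef 0 = @lc_counit K V.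
Proof. by apply/funext => v; exact: cc_zeta0. Qed.

Lemma functional_zeta_word s : functional (zeta_word s).
Proof.
elim: s => [|n s IH]; first exact: functional_counit.
by apply: functional_conv => //; exact: functional_zeta_coef.
Qed.

Lemma zeta_word_cat s t :
  zeta_word (s ++ t) = conv (zeta_word s) (zeta_word t).
Proof.
elim: s => [|n s IH] /=; first by rewrite conv1l //; exact: functional_zeta_word.
rewrite IH convA //; try exact: functional_zeta_word.
exact: functional_zeta_coef.
Qed.

Lemma zeta_word1 n : zeta_word [:: n] = zeta_coef n.
Proof. by rewrite /= conv1r //; exact: functional_zeta_coef. Qed.

Lemma zeta_word_strip s : zeta_word (val (strip s)) = zeta_word s.
Proof.
elim: s => [|[|n] s IH] //=; last by rewrite -IH.
rewrite zeta_coef0 conv1l //; exact: functional_zeta_word.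
Qed.

Lemma lc_comul_iter_linear n : linear (@lc_comul_iter K V n).
Proof.
elim: n => [|n IH] //= a x y /=; have [lD _] := lc_comul_map V.
by rewrite lD lc_tmap_linear.
Qed.

(** The iterated coproduct is bracketed to the left, whereas [zeta_word] is
bracketed to the right; associativity of the convolution reconciles them
through [zeta_word_cat]. *)
Lemma zeta_tpowE (a : nat -> nat) n (v : V) :
  lc_coord (lc_tpow_map (@cc_zeta K V) (lc_comul_iter n v))
    (lc_tpow_idx (V := kt K) a n) = zeta_word (mkseq a n.+1) v.
Proof.
elim: n v => [|n IH] v; first by rewrite zeta_word1.
rewrite mkseqS -cats1 zeta_word_cat zeta_word1.
(* The coefficient at the first n + 1 letters, as a functional on the tensor
   power; the claim then has the form required by [tens_tmap]. *)
pose l z := lc_coord (lc_tpow_map (@cc_zeta K V) (n := n) z)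
  (lc_tpow_idx (V := kt K) a n).
rewrite -[LHS]/(tens l (zeta_coef (a n.+1))
  (lc_tmap (@lc_comul_iter K V n) id (lc_comul v))).
rewrite tens_tmap; last 2 first.
- exact: lc_comul_iter_linear.
- exact: functional_zeta_coef.
rewrite (_ : l \o _ = zeta_word (mkseq a n.+1)) //.
by apply/funext => w; exact: IH.
Qed.

Lemma zeta_compE (c : composition) : zeta_comp c = zeta_word (val c) :> (V -> K).
Proof.
apply/funext => v; rewrite /zeta_comp.
case E: (val c) => [|n s]; first exact: cc_zeta0.
by rewrite zeta_tpowE [(size _).-1.+1]/= -[(size s).+1]/(size (n :: s)) mkseq_nth.
Qed.

Lemma psiE (v : V) (c : composition) : psi v c = zeta_word (val c) v.
Proof. by rewrite -zeta_compE. Qed.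

Lemma psi_map : lc_map (@psi K V).
Proof.
split=> [a x y|].
  apply/funext => c; rewrite -[RHS]/(a * psi x c + psi y c) !psiE.
  exact: functional_linear (functional_zeta_word _) a x y.
apply: kpow_continuous => c.
rewrite (_ : (fun v => _) = zeta_word (val c)); last first.
  by apply/funext => v; exact: psiE.
exact: functional_continuous (functional_zeta_word _).
Qed.

Lemma psi_tmapE (z : lc_tens V V) (a b : composition) :
  lc_tmap (@psi K V) (@psi K V) z (a, b) =
  tens (zeta_word (val a)) (zeta_word (val b)) z.
Proof.
rewrite -[LHS]/(tens (fun v => psi v a) (fun v => psi v b) z).
by congr (tens _ _ z); apply/funext => v; exact: psiE.
Qed.

Lemma psi_coalg_mor : lc_coalg_mor (B := cb_cc (QSym K)) (@psi K V).
Proof.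
split; first exact: psi_map.
  move=> v; apply/funext => -[a b].
  by rewrite psi_tmapE -[LHS]/(psi v (comp_cat a b)) psiE /= zeta_word_cat.
by move=> v; exact: psiE v comp_nil.
Qed.

Lemma psi_zeta (v : V) : cc_zeta v = cc_zeta (psi v).
Proof.
apply/funext => n; rewrite -[RHS]/(psi v (strip [:: n])).
by rewrite psiE zeta_word_strip zeta_word1.
Qed.

(** The first letter of the word is read off by compatibility with zeta, and
the remaining ones by compatibility with the coproduct; the empty word is
compatibility with the counit. *)
Lemma cc_mor_coefE (phi : V -> cb_cc (QSym K)) : lc_cc_mor phi ->
  forall s v, phi v (strip s) = zeta_word s v.
Proof.
move=> [[phi_map phi_comul phi_counit] phi_zeta].
elim=> [|n s IH] v; first by rewrite strip_nil; exact: phi_counit.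
rewrite -[n :: s]/([:: n] ++ s) strip_cat.
have := congr1 (fun z : lc_tens (qs_space K) (qs_space K) =>
  z (strip [:: n], strip s)) (phi_comul v).
rewrite -[LHS]/(phi v (comp_cat (strip [:: n]) (strip s))) => ->.
rewrite -[LHS]/(tens (fun w => phi w (strip [:: n]))
  (fun w => phi w (strip s)) (lc_comul v)).
rewrite (_ : (fun w => phi w (strip s)) = zeta_word s); last exact/funext.
congr (tens _ _ _); apply/funext => w.
by rewrite /zeta_coef phi_zeta.
Qed.

Lemma cc_mor_unique (phi : V -> cb_cc (QSym K)) : lc_cc_mor phi -> phi = @psi K V.
Proof.
move=> phi_mor; apply/funext => v; apply/funext => c.
by rewrite psiE -[in LHS](strip_val c) cc_mor_coefE.
Qed.

End WordFunctionals.

(** * Multiplicativity for combinatorial bialgebras *)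

Section Multiplicativity.
Context {K : fieldType} (V : lcCombBialgebra K).

Local Notation zeta_word := (@zeta_word K (cb_cc V)).
Local Notation zeta_coef := (@zeta_coef K (cb_cc V)).

Lemma zeta_coef_mul n (z : lc_tens V V) :
  zeta_coef n (lc_mul z) =
  \sum_(0 <= i < n.+1) tens (zeta_coef i) (zeta_coef (n - i)) z.
Proof.
rewrite /zeta_coef /= (alg_morM (@cb_zeta_mor K V)) big_mkord.
by [].
Qed.

(** Splitting off the first letter n, the multiplicativity of the coproduct
brings zeta_n and the functional of the remaining word to act on separate
products.  Both are then expanded, by [zeta_coef_mul] and by induction, and the
interchange of the middle factors regroups the result into convolutions. *)
Lemma zeta_word_mul s (z : lc_tens V V) :
  zeta_word s (lc_mul z) =
  ssum s (fun p q => tens (zeta_word p) (zeta_word q) z).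
Proof.
elim: s z => [|n s IH] z; first exact: bi_counitM.
have [lD _] := @bi_comul_map K V.
rewrite -[LHS]/(tens (zeta_coef n) (zeta_word s) (bi_comul (lc_mul z))).
rewrite bi_comulM tens_tmap; last 2 first.
- by case: (lc_mul_map V).
- exact: (@functional_zeta_word K (cb_cc V)).
rewrite (_ : zeta_coef n \o _ =
    fun w => \sum_(0 <= i < n.+1) tens (zeta_coef i) (zeta_coef (n - i)) w);
  last by apply/funext => w; exact: zeta_coef_mul.
rewrite (_ : zeta_word s \o _ = fun w =>
    \sum_(p <- splits s) tens (zeta_word p.1) (zeta_word p.2) w); last first.
  by apply/funext => w; rewrite /= IH ssumE.
rewrite tens_sum; last first.
  by move=> i; apply: functional_tens; exact: (@functional_zeta_coef K (cb_cc V)).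
rewrite ssum_cons; apply: eq_bigr => i _; rewrite ssumE; apply: eq_bigr => p _.
(* From (zeta_i, zeta_(n-i)) and (p, q) to (zeta_i, p) and (zeta_(n-i), q). *)
rewrite tens_mid4; last 2 first.
- exact: (@functional_zeta_word K (cb_cc V)).
- exact: (@functional_zeta_coef K (cb_cc V)).
rewrite tens_tmap //; apply: functional_tens; last exact: (@functional_zeta_word K (cb_cc V)).
exact: (@functional_zeta_coef K (cb_cc V)).
Qed.

(** A letter n > 0 kills the unit, because zeta sends it to the constant
series. *)
Lemma zeta_word_one s (c : lc_unit K) : all (leq 1) s ->
  zeta_word s (lc_one V c) = if s is [::] then (c : K) else 0.
Proof.
case: s => [|n s] /= => [_|/andP[n_gt0 _]]; first exact: bi_counit1.
rewrite /conv /= bi_comul1 lc_tmap_pure; try by case: (lc_one_map V).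
rewrite tens_pure; last 2 first.
- exact: (@functional_zeta_coef K (cb_cc V)).
- exact: (@functional_zeta_word K (cb_cc V)).
rewrite /zeta_coef /= (alg_mor1 (@cb_zeta_mor K V)).
by case: n n_gt0 => //= n _; rewrite mul0r.
Qed.

Lemma psi_alg_mor : lc_alg_mor (B := QSym K) (@psi K (cb_cc V)).
Proof.
split; first exact: (@psi_map K (cb_cc V)).
  move=> z; apply/funext => c; rewrite (@psiE K (cb_cc V)) zeta_word_mul.
  rewrite -[RHS]/(qs_mul (lc_tmap (@psi K (cb_cc V)) (@psi K (cb_cc V)) z) c).
  rewrite qs_mulE; apply: eq_ssum => p q.
  by rewrite (@psi_tmapE K (cb_cc V)) !(@zeta_word_strip K (cb_cc V)).
move=> u; apply/funext => c; rewrite (@psiE K (cb_cc V)) zeta_word_one; last exact: (valP c).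
rewrite -[RHS]/(if c == comp_nil then u : K else 0) -val_eqE /=.
by case: (parts c).
Qed.

End Multiplicativity.

Theorem theorem7p8 (K : fieldType) :
  (forall V : lcCombCoalgebra K,
     lc_cc_mor (@psi K V) /\
     forall phi : V -> cb_cc (QSym K), lc_cc_mor phi -> phi = @psi K V) /\
  (forall V : lcCombBialgebra K,
     @lc_bialg_mor K V (QSym K) (@psi K (cb_cc V))).
Proof.
split=> V.
  split; last exact: cc_mor_unique.
  by split; [exact: psi_coalg_mor | exact: psi_zeta].
by split; [exact: psi_alg_mor | exact: (psi_coalg_mor (cb_cc V))].
Qed.
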